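(* Let $k>1$ be an integer and let $p_k$ denote the $k$-th prime. For any point $(\alpha,\beta)\in\omega(2p_k)$, the ratio $$\frac{\Omega_0\big(p_k\,|\,\alpha,\beta\,|\,2p_k\big)}{\Psi(\alpha,\beta,2p_k)}$$ is an integer, and $$p_{k+1}\ \Big|\ \frac{\Omega_0\big(p_k\,|\,\alpha,\beta\,|\,2p_k\big)}{\Psi(\alpha,\beta,2p_k)}.$$ Moreover, for any finite set $\varpi\subset\omega(2p_k)$ and any finite set $I$ of integers, $$p_{k+1}\ \Big|\ \sum_{(\alpha,\beta)\in\varpi,\ \lambda\in I}\lambda\,\frac{\Omega_0\big(p_k\,|\,\alpha,\beta\,|\,2p_k\big)}{\Psi(\alpha,\beta,2p_k)}.$$
   Context: For an integer $m\ge 0$, $\delta(m)\in\{0,1\}$ is the residue of $m$ modulo $2$. For real $(a,b)\neq(0,0)$ the sequence $\Psi(n)=\Psi(a,b,n)$ is defined by $\Psi(0)=2$, $\Psi(1)=1$, $\Psi(n+1)=(2a-b)^{\delta(n)}\Psi(n)-a\Psi(n-1)$ for $n\ge1$ (with $t^0=1$ for every $t$). For a positive integer $n$ and a point $(\zeta,\xi)\ne(0,0)$, the Omega sequence $\Omega_r(k|\zeta,\xi|n)$, for integers $r,k\ge 0$ with $r+k\le\lfloor n/2\rfloor$, is defined by $\Omega_r(0|\zeta,\xi|n)=1$ for all $r$ and, for $k\ge 1$, $$\Omega_r(k|\zeta,\xi|n)=(2\zeta-\xi)(n-r-k)\,\Omega_r(k-1|\zeta,\xi|n)-2\zeta\,(n-2r-\delta(n-1))\,\Omega_{r+1}(k-1|\zeta,\xi|n).$$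 The Omega space at level $n$ is $\omega(n)=\{(a,b)\,:\,(a,b)\neq(0,0),\ \Psi(a,b,n)\ne 0\}$ (pairs of real numbers). The primes are indexed $p_1=2,p_2=3,\dots$. *)

(* Defs.v *)
From HB Require Import structures.
From mathcomp Require Import all_boot all_order all_algebra.
From mathcomp Require Import finmap reals.

Set Implicit Arguments.
Unset Strict Implicit.
Unset Printing Implicit Defensive.

Import Order.TTheory GRing.Theory Num.Theory.

Local Open Scope ring_scope.

Lemma exists_prime_gt (m : nat) : exists p, (m < p)%N && prime p.
Proof. by have [p lt_mp p_pr] := prime_above m; exists p; rewrite lt_mp. Qed.

Definition next_prime (m : nat) : nat := ex_minn (exists_prime_gt m).

(* Indexed from 1: nth_prime 1 = 2 and nth_prime 2 = 3; the value at 0 is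
   meaningless. *)
Definition nth_prime (k : nat) : nat := iter k.-1 next_prime 2.

Definition delta (m : nat) : nat := (m %% 2)%N.

(* The index n >= 1 of the recurrence for Psi (n + 1) is n'.+1 here. *)
Fixpoint Psi (R : realType) (a b : R) (n : nat) {struct n} : R :=
  match n with
  | 0 => 2
  | 1 => 1
  | (n'.+1 as n1).+1 => (2 * a - b) ^+ delta n1 * Psi a b n1 - a * Psi a b n'
  end.

(* Omega r k zeta xi n is Omega_r(k | zeta, xi | n).  It is total, but only
   meaningful for r + k <= n./2, a range which the recursion does not leave.
   The coefficients are computed in R, not with truncated subtraction. *)
Fixpoint Omega (R : realType) (r k : nat) (zeta xi : R) (n : nat) {struct k} : R :=
  match k with
  | 0 => 1
  | k'.+1 =>
      (2 * zeta - xi) * (n%:R - r%:R - k'.+1%:R) * Omega r k' zeta xi n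
      - 2 * zeta * (n%:R - 2 * r%:R - (delta (n - 1))%:R)
          * Omega r.+1 k' zeta xi n
  end.

Definition omega (R : realType) (n : nat) : {pred R * R} :=
  [pred ab : R * R | (ab != (0, 0)) && (Psi ab.1 ab.2 n != 0)].

Arguments omega R n : clear implicits.

Definition int_multiple (R : realType) (d : nat) (x : R) : Prop :=
  exists2 m : int, x = m%:~R & (d%:Z %| m)%Z.

(* Main.v *)
Require Import Defs.
From mathcomp Require Import all_boot all_order all_algebra.
From mathcomp Require Import finmap reals.
From mathcomp Require Import zify ring.

(** Write [c = 2 a - b].  The ratio does not depend on the point: for [m > 0],
      Omega_0 (m | a, b | 2 m) = (2 m - 1) (2 m - 2) ... m * Psi (a, b, 2 m)
    ([Omega_Psi]), so on the Omega space it is the falling factorial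
    [(2 m - 1) ^_ m].  The identity comes from expanding both sides in the
    monomials [(- a) ^+ j * c ^+ (m - j)].  If [x] and [y] satisfy [x y = a] and
    [(x + y) ^ 2 = c], then [Psi n] is [x ^ n + y ^ n], divided by [x + y] when
    [n] is odd; hence its coefficients are those of the Lucas polynomials
    ([Psi_closed], with the product formula [lucas_fact] for the coefficients).
    The recursion of Omega is solved by binomial coefficients times products of
    consecutive factors ([Omega_closed]), and the two lists of coefficients
    differ by the factor above.

    For [m = p] prime this falling factorial is the product of the integers from
    [p] to [2 p - 1].  The prime that follows [p > 2] is one of them by
    Bertrand's postulate ([bertrand]), and this is what the divisibility amounts
    to.  The argument for the postulate is the one of Erdos.  The binomial
    coefficient [C(2 n, n)] is at least [4 ^ n / (2 n)].  In its prime
    factorization every prime power is at most [2 n], no prime above the square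
    root of [2 n] occurs twice, and no prime in (2 n / 3, n] occurs.  If there
    were no prime in (n, 2 n] either, then the bound [4 ^ u] on the product of
    the primes up to [u] would make [C(2 n, n)] at most
    [(2 n) ^ sqrt (2 n) * 4 ^ (2 n / 3)], which is too small once [n > 480].

    The statement on sums follows, because the multiples of an integer are
    closed under sums and under products with integers. *)

Import Order.TTheory GRing.Theory Num.Theory.

Set Implicit Arguments.
Unset Strict Implicit.

(** * Primes dividing factorials *)

Lemma prime_dvd_fact p n : prime p -> (p %| n`!) = (p <= n).
Proof.
move=> pp; apply/idP/idP => [|le_pn]; last by rewrite dvdn_fact ?prime_gt0.
elim: n => [|n IHn]; first by rewrite Euclid_dvd1.
by rewrite factS Euclid_dvdM // => /orP[/dvdn_leq -> //|/IHn/leqW].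
Qed.

Lemma prime_dvd_ffact p n m : prime p -> m <= n -> n - m < p <= n ->
  p %| n ^_ m.
Proof.
move=> pp le_mn /andP[lt_p le_p].
have : p %| n`! by rewrite prime_dvd_fact.
by rewrite -(ffact_fact le_mn) Euclid_dvdM // !prime_dvd_fact // leqNgt lt_p orbF.
Qed.

(** * Upper bound for the product of the primes up to n *)

Lemma prod_primes_dvd a b N :
  (forall p, a <= p < b -> prime p -> p %| N) ->
  \prod_(a <= p < b | prime p) p %| N.
Proof.
have [le_ab|lt_ba] := leqP a b; last by rewrite big_geq ?dvd1n // ltnW.
elim: b le_ab => [|b IHb] le_ab dvdN; first by rewrite big_geq ?dvd1n.
move: le_ab; rewrite leq_eqVlt => /orP[/eqP->|]; first by rewrite big_geq ?dvd1n.
rewrite ltnS => le_ab.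
rewrite big_mkcond big_nat_recr //= -big_mkcond /=.
have IH : \prod_(a <= p < b | prime p) p %| N.
  apply: IHb => // p /andP[ap pb] pp; apply: dvdN pp; lia.
case: ifP => pb; last by rewrite muln1.
rewrite Gauss_dvd ?IH /=; first by apply: dvdN => //; lia.
rewrite big_nat_cond; elim/big_ind: _ => [|x y cx cy|p]; first exact: coprime1n.
  by rewrite coprimeMl cx.
move=> /andP[/andP[_ lt_pb] pp]; rewrite prime_coprime // dvdn_prime2 //; lia.
Qed.

Lemma bin_prime_dvd m p : prime p -> m.+1 < p <= m.*2.+1 ->
  p %| 'C(m.*2.+1, m).
Proof.
move=> pp /andP[lt_p le_p].
have : p %| m.*2.+1 ^_ m by apply: prime_dvd_ffact => //; lia.
by rewrite -bin_ffact Euclid_dvdM // prime_dvd_fact // => /orP[//|]; lia.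
Qed.

(** This coefficient occurs twice, at [m] and at [m + 1], in the expansion of
    [(1 + 1) ^ (2 m + 1)]. *)
Lemma bin_odd_le m : 'C(m.*2.+1, m) <= 4 ^ m.
Proof.
have E : 2 * 4 ^ m = \sum_(i < m.*2.+2) 'C(m.*2.+1, i).
  rewrite -[4]/(2 ^ 2) -expnM -expnS mul2n -[2]/(1 + 1) expnDn.
  by apply: eq_bigr => i _; rewrite !exp1n !muln1.
rewrite -(@leq_pmul2l 2) // E mul2n -addnn -{2}bin_sub; last lia.
have lt1 : m < m.*2.+2 by lia.
have lt2 : m.*2.+1 - m < m.*2.+2 by lia.
rewrite (bigD1 (Ordinal lt1)) //= (bigD1 (Ordinal lt2)) //=.
  by rewrite addnA leq_addr.
by apply/eqP => -[]; lia.
Qed.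

(** An even [n > 2] is no prime, so only odd [n = 2 m + 1] matter; there the
    primes above [m + 1] divide [C(2 m + 1, m) <= 4 ^ m], and the others are
    covered by induction. *)
Lemma primorial_le n : \prod_(1 <= p < n.+1 | prime p) p <= 4 ^ n.
Proof.
elim/ltn_ind: n => -[|n] IH; first by rewrite big_geq.
have step : prime n.+1 = false \/ n.+1 = 2 \/ exists2 m, 0 < m & n = m.*2.
  case: (boolP (prime n.+1)) => pn; last by left.
  right; case: (even_prime pn) => [->|odn]; first by left.
  right; exists n./2; last by move: odn => /=; lia.
  by case: n pn odn {IH} => [|[|n]].
case: step => [np|[->|[m m_gt0 n2]]].
- rewrite big_mkcond big_nat_recr //= np muln1 -big_mkcond.
  apply: leq_trans (IH n _) _ => //; by rewrite leq_exp2l.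
- by rewrite /index_iota /= !big_cons big_nil.
- rewrite n2 (big_cat_nat (n := m.+2)) //=; last by lia.
  have -> : m.*2.+1 = m.+1 + m by lia.
  rewrite expnD; apply: leq_mul; first by apply: IH; lia.
  apply: leq_trans (bin_odd_le m); apply: dvdn_leq; first by rewrite bin_gt0; lia.
  have -> : (m.+1 + m) = m.*2.+1 by lia.
  apply: prod_primes_dvd => p /andP[p1 p2] pp.
  by apply: bin_prime_dvd => //; lia.
Qed.

(** * Prime factorization of the central binomial coefficient *)

(** Passing from [n] to [n + 1] multiplies the right-hand side by
    [2 (2 n + 1) / n >= 4]. *)
Lemma bin_central_ge n : 0 < n -> 4 ^ n <= n.*2 * 'C(n.*2, n).
Proof.
case: n => // n _; elim: n => // n IHn.
have E : n.+2 * 'C(n.+2.*2, n.+2) = 2 * n.*2.+3 * 'C(n.+1.*2, n.+1).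
  have lt1 : n.+1 <= n.+1.*2 by lia.
  have lt2 : n.+2 <= n.+2.*2 by lia.
  have := bin_fact lt1; have := bin_fact lt2.
  have -> : n.+2.*2 - n.+2 = n.+2 by lia.
  have -> : n.+1.*2 - n.+1 = n.+1 by lia.
  have -> : n.+2.*2 = n.+1.*2.+2 by lia.
  rewrite [n.+1.*2.+2`!]factS [n.+1.*2.+1`!]factS [n.+2`!]factS => E2 E1.
  have f0 : 0 < n.+2 * (n.+1`! * n.+1`!) by rewrite !muln_gt0 fact_gt0.
  apply/eqP; rewrite -(eqn_pmul2r f0); apply/eqP.
  transitivity ('C(n.+1.*2.+2, n.+2) * (n.+2 * n.+1`! * (n.+2 * n.+1`!))).
    by ring.
  by rewrite E2 -E1 -!mul2n; ring.
rewrite expnS -[X in _ <= X * _]mul2n -mulnA E.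
apply: leq_trans (leq_mul (leqnn 4) IHn) _.
rewrite !mulnA leq_mul2r; apply/orP; right; lia.
Qed.

(** Legendre's formula for the factorials; the common upper end [M] of the sums,
    beyond which all terms vanish, allows comparing them term by term. *)
Lemma logn_bin_central p n M : prime p -> n.*2 < M ->
  logn p 'C(n.*2, n) + 2 * \sum_(1 <= k < M) n %/ p ^ k
   = \sum_(1 <= k < M) n.*2 %/ p ^ k.
Proof.
move=> pp ltM.
have ext m : m < M -> logn p m`! = \sum_(1 <= k < M) m %/ p ^ k.
  move=> lt_mM; rewrite logn_fact // [RHS](big_cat_nat (n := m.+1)) //=.
  rewrite [X in _ = _ + X]big_nat_cond [X in _ = _ + X]big1 ?addn0 // => k.
  rewrite andbT => /andP[lt_mk _]; apply: divn_small.
  by apply: ltn_trans lt_mk (ltn_expl _ (prime_gt1 pp)).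
rewrite -!ext //; last lia.
have le : n <= n.*2 by lia.
rewrite -(bin_fact le) !lognM ?muln_gt0 ?fact_gt0 ?bin_gt0 //.
by rewrite -addnn addnK; lia.
Qed.

Lemma div_double_le n d : n.*2 %/ d <= (n %/ d).*2.+1.
Proof.
have [->|d0] := posnP d; first by rewrite !divn0.
rewrite -ltnS ltn_divLR //; have := ltn_ceil n d0; nia.
Qed.

(** In Legendre's formula the [k]-th term contributes at most one, and nothing
    once [p ^ k] exceeds [2 n]. *)
Lemma logn_bin_central_le p n t : prime p -> n.*2 < p ^ t.+1 ->
  logn p 'C(n.*2, n) <= t.
Proof.
move=> pp lt_pt; pose M := (n.*2 + t).+2.
have /(_ _)/esym := @logn_bin_central p n M pp.
have -> : n.*2 < M by rewrite /M; lia.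
move=> /(_ isT) E; rewrite -(leq_add2r (2 * \sum_(1 <= k < M) n %/ p ^ k)) -E.
rewrite (big_cat_nat (n := t.+1)) //=; last by rewrite /M; lia.
rewrite [X in _ + X <= _]big_nat_cond [X in _ + X <= _]big1 ?addn0; last first.
  move=> k; rewrite andbT => /andP[lt_tk _]; apply: divn_small.
  by apply: leq_trans lt_pt _; rewrite leq_exp2l ?prime_gt1.
rewrite [X in _ <= _ + 2 * X](big_cat_nat (n := t.+1)) //=; last by rewrite /M; lia.
rewrite mulnDr addnA; apply: leq_trans (leq_addr _ _).
have {2}-> : t = \sum_(1 <= k < t.+1) 1 by rewrite sum_nat_const_nat; lia.
rewrite [2 * _]big_distrr /= -big_split /=; apply: leq_sum => k _.
by have := div_double_le n (p ^ k); lia.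
Qed.

Lemma pfactor_bin_central_le p n : 0 < n -> prime p ->
  p ^ logn p 'C(n.*2, n) <= n.*2.
Proof.
move=> n0 pp; have n20 : 0 < n.*2 by lia.
have /andP[le1 lt2] := trunc_log_bounds (prime_gt1 pp) n20.
apply: leq_trans le1; rewrite leq_exp2l ?prime_gt1 //.
exact: logn_bin_central_le.
Qed.

(** Such a [p] divides [(2 n)!] exactly twice, in [p] and [2 p], and [n!] exactly
    once. *)
Lemma logn_bin_central_eq0 p n : prime p -> n.*2 < p ^ 2 ->
  n.*2 < 3 * p -> p <= n -> logn p 'C(n.*2, n) = 0.
Proof.
move=> pp lt_p2 lt_3p le_pn.
have := @logn_bin_central p n n.*2.+2 pp; rewrite ltnS leqnSn => /(_ isT).
have red m : m <= n.*2 -> \sum_(1 <= k < n.*2.+2) m %/ p ^ k = m %/ p.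
  move=> le_m; rewrite big_ltn // expn1.
  rewrite big_nat_cond big1 ?addn0 // => k; rewrite andbT => /andP[le2k _].
  apply: divn_small; apply: leq_ltn_trans le_m _.
  by apply: leq_trans lt_p2 _; rewrite leq_exp2l // prime_gt1.
rewrite !red; [|lia..].
have p0 := prime_gt0 pp.
have -> : n %/ p = 1.
  have lt2 : n %/ p < 2 by rewrite ltn_divLR //; lia.
  by apply/eqP; rewrite eqn_leq -ltnS lt2 divn_gt0.
have lt3 : n.*2 %/ p < 3 by rewrite ltn_divLR //; lia.
by move: lt3; move: (n.*2 %/ p) => x; lia.
Qed.

(** * Bertrand's postulate *)

Lemma sqrt_bounds n : exists s, s ^ 2 <= n < s.+1 ^ 2.
Proof.
elim: n => [|n [s /andP[le_sn lt_ns]]]; first by exists 0.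
have [lt_n1|le_n1] := ltnP n.+1 (s.+1 ^ 2).
  by exists s; rewrite (leqW le_sn).
exists s.+1; rewrite le_n1 /=; apply: leq_ltn_trans lt_ns _.
by rewrite ltn_exp2r.
Qed.

(** The two sides agree at [t = 32], and from there on the left one grows by less
    than the factor [2]; this decides the threshold of [bertrand_large]. *)
Lemma expn6_le t : 32 <= t -> t ^ 6 <= 2 ^ (t - 2).
Proof.
move=> le32; rewrite -(subnK le32); move: (t - 32) => d {le32 t}.
elim: d => [|d IHd].
  (* Both sides are [2 ^ 30]. *)
  rewrite add0n -[X in X ^ _]/(2 ^ 5) -expnM leq_exp2l //.
set t := d + 32 in IHd *; rewrite addSn -/t.
have -> : t.+1 - 2 = (t - 2).+1 by rewrite /t; lia.
rewrite [X in _ <= X]expnS.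
apply: (@leq_trans (2 * t ^ 6)); last by rewrite leq_mul2l.
(* [(t + 1) ^ 6 <= (5 / 4) ^ 3 t ^ 6], and [125 / 64 < 2]. *)
have le1 : 4 * t.+1 ^ 2 <= 5 * t ^ 2.
  have : 32 <= t by rewrite /t leq_addl.
  by move: (t) => x; rewrite !expnS !expn0; nia.
have : (4 * t.+1 ^ 2) ^ 3 <= (5 * t ^ 2) ^ 3 by rewrite leq_exp2r.
rewrite [(4 * _) ^ 3]expnMn [(5 * _) ^ 3]expnMn -!expnM => le2.
rewrite -(@leq_pmul2l (4 ^ 3)) //; apply: leq_trans le2 _.
by rewrite mulnA leq_mul2r; apply/orP; right.
Qed.

Lemma prod_pfactor N M : 0 < N -> N < M -> N = \prod_(1 <= p < M) p ^ logn p N.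
Proof.
move=> N0 lt_NM; have M0 : 0 < M by lia.
rewrite -{1}(partnT N0) (widen_partn predT (_ : N <= M.-1)); last lia.
by rewrite prednK // [LHS]big_ltn //= expn0 mul1n.
Qed.

(** The factorization is split at [s], the integer part of the square root of
    [2 n], and at [u], that of [2 n / 3]: up to [s] each prime power is at most
    [2 n], between [s] and [u] the exponents are at most one, and above [u] they
    vanish. *)
Lemma bin_central_no_prime n s : 2 < s -> s ^ 2 <= n.*2 < s.+1 ^ 2 ->
  (forall p, prime p -> n < p -> n.*2 < p) ->
  'C(n.*2, n) <= n.*2 ^ s * 4 ^ (n.*2 %/ 3).
Proof.
move=> s2 /andP[le_s lt_s] noprime.
set u := n.*2 %/ 3; set N := 'C(_, _).
have n0 : 0 < n by nia.
have N0 : 0 < N by rewrite bin_gt0; lia.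
have le_su : s <= u by rewrite /u leq_divRL //; nia.
rewrite (@prod_pfactor N (N + u).+2) //; last lia.
have not_prime p : ~~ prime p -> p ^ logn p N = 1.
  by rewrite lognE => /negbTE ->.
rewrite (big_cat_nat (n := u.+1)) //=; last lia.
rewrite [X in _ * X]big_nat_cond [X in _ * X]big1 ?muln1; last first.
  move=> p; rewrite andbT => /andP[lt_up _].
  have [pp|/not_prime //] := boolP (prime p).
  have lt_3p : n.*2 < 3 * p by rewrite mulnC -ltn_divLR.
  have lt_p2 : n.*2 < p ^ 2.
    by apply: leq_trans lt_s _; rewrite leq_exp2r //; lia.
  have [le_pn|lt_np] := leqP p n; first by rewrite logn_bin_central_eq0.
  have := @logn_bin_central_le p n 0 pp; rewrite expn1 leqn0.
  by move=> /(_ (noprime p pp lt_np)) /eqP ->.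
rewrite (big_cat_nat (n := s.+1)) //=; apply: leq_mul.
  have {2}-> : s = s.+1 - 1 by lia.
  rewrite -prod_nat_const_nat; apply: leq_prod => p _.
  have [pp|/not_prime ->] := boolP (prime p); last lia.
  exact: pfactor_bin_central_le.
apply: leq_trans (primorial_le u).
rewrite [X in _ <= X](big_cat_nat (n := s.+1)) //=.
rewrite -[X in X <= _]mul1n; apply: leq_mul.
  by rewrite prodn_cond_gt0 // => p /prime_gt0.
rewrite [X in _ <= X]big_mkcond /=.
rewrite big_nat_cond [X in _ <= X]big_nat_cond; apply: leq_prod => p.
rewrite andbT => /andP[lt_sp _].
have [pp|/not_prime -> //] := boolP (prime p).
rewrite -[X in _ <= X]expn1 leq_exp2l ?prime_gt1 //.
apply: logn_bin_central_le => //; apply: leq_trans lt_s _.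
by rewrite leq_exp2r.
Qed.

(** Otherwise the two bounds on the central binomial coefficient give
    [4 ^ (n / 3) <= (2 n) ^ (s + 1)], where [s] is the integer part of the square
    root of [2 n].  Cubing, and using [s ^ 2 <= 2 n < (s + 1) ^ 2], one gets
    [2 ^ (s ^ 2) <= (s + 1) ^ (6 (s + 1))], which is at most
    [2 ^ ((s - 1) (s + 1))] by [expn6_le]. *)
Lemma bertrand_large n : 480 < n -> exists2 p, prime p & n < p <= n.*2.
Proof.
move=> n_large.
have [/hasP[p]|/hasPn none] := boolP (has prime (index_iota n.+1 n.*2.+1)).
  by rewrite mem_index_iota => lt_p pp; exists p.
have noprime p : prime p -> n < p -> n.*2 < p.
  move=> pp lt_np; rewrite ltnNge; apply/negP => le_p.
  by have := none p; rewrite mem_index_iota pp lt_np ltnS le_p => /(_ isT).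
have [s s_bounds] := sqrt_bounds n.*2; have /andP[le_s lt_s] := s_bounds.
have s31 : 31 <= s.
  rewrite leqNgt; apply/negP => s_small.
  have : s.+1 ^ 2 <= 31 ^ 2 by rewrite leq_exp2r.
  have -> : 31 ^ 2 = 961 by [].
  by move=> le961; lia.
have n0 : 0 < n by lia.
have leC := bin_central_no_prime (_ : 2 < s) s_bounds noprime.
have := bin_central_ge n0; have {}leC := leC (ltn_trans _ s31).
set u := n.*2 %/ 3 in leC *; have lt_u : u * 3 <= n.*2 by apply: leq_divM.
move=> le4.
have {leC}le4 : 4 ^ n <= n.*2 ^ s.+1 * 4 ^ u.
  apply: leq_trans le4 _; rewrite expnS -mulnA leq_mul2l; apply/orP; right.
  exact: leC.
have le4' : 4 ^ (n - u) <= n.*2 ^ s.+1.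
  rewrite -(@leq_pmul2r (4 ^ u)) ?expn_gt0 // -expnD subnK //; lia.
have : 2 ^ (s ^ 2) <= 2 ^ ((s - 1) * s.+1).
  apply: (@leq_trans (4 ^ ((n - u) * 3))).
    rewrite -[4]/(2 ^ 2) -expnM leq_exp2l //; lia.
  apply: (@leq_trans ((s.+1 ^ 2) ^ (s.+1 * 3))).
    rewrite expnM [X in _ <= X]expnM leq_exp2r //.
    by apply: leq_trans le4' _; rewrite leq_exp2r // ltnW.
  rewrite -expnM; have -> : 2 * (s.+1 * 3) = 6 * s.+1 by ring.
  rewrite [X in X <= _]expnM [X in _ <= X]expnM leq_exp2r //.
  by have := @expn6_le s.+1; rewrite ltnS subSS; apply.
by rewrite leq_exp2l //; nia.
Qed.

Theorem bertrand n : 0 < n -> exists2 p, prime p & n < p <= n.*2.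
Proof.
move=> n0; have [|] := ltnP 480 n; first exact: bertrand_large.
move=> n_small.
have small p q : prime q -> q <= p.*2 ->
  (n < p -> exists2 p, prime p & n < p <= n.*2) ->
  n < q -> exists2 p, prime p & n < p <= n.*2.
  move=> qp le_qp IH lt_nq; have [//|le_pn] := ltnP n p; exists q => //; lia.
(* From 2 to 631, each prime of this chain is less than twice the one before. *)
have : n < 631 by lia.
do [apply: (small 317) => //; apply: (small 163) => //; apply: (small 83) => //;
 apply: (small 43) => //; apply: (small 23) => //; apply: (small 13) => //;
 apply: (small 7) => //; apply: (small 5) => //; apply: (small 3) => //;
 apply: (small 2) => //; apply: (small 1) => //].
by lia.
Qed.

(** * The coefficients of Psi *)

Local Open Scope ring_scope.

(** With [n = i + 2 j > 0], this is the coefficient [n / (n - j) * C(n - j, j)] of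
    [(x + y) ^ i * (- x y) ^ j] in [x ^ n + y ^ n]; the recursion is the one of
    [x ^ n + y ^ n], and indexing by [i] avoids the condition [2 j <= n]. *)
Fixpoint lucas (i : nat) : nat -> nat :=
  fix lucas_i (j : nat) : nat :=
    match i, j with
    | 0, _ => 2
    | _.+1, 0 => 1
    | i'.+1, j'.+1 => lucas i' j'.+1 + lucas_i j'
    end%N.

Lemma lucasSS i j : lucas i.+1 j.+1 = (lucas i j.+1 + lucas i.+1 j)%N.
Proof. by []. Qed.

Lemma lucasS0 i : lucas i.+1 0 = 1%N.
Proof. by []. Qed.

Lemma lucas0n j : lucas 0 j = 2%N. Proof. by case: j. Qed.

Arguments lucas : simpl never.

Lemma lucas_fact i j : (0 < i + j)%N ->
  (lucas i j * (i`! * j`!) = (i + 2 * j) * (i + j).-1`!)%N.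
Proof.
elim: i j => [|i IHi] j.
  by case: j => // j _; rewrite lucas0n factS fact0 /=; ring.
elim: j => [|j IHj] _; first by rewrite lucasS0 addn0 factS fact0 /=; ring.
rewrite lucasSS.
have E1 : (lucas i j.+1 * (i`! * j.+1`!) = (i + 2 * j.+1) * (i + j)`!)%N.
  by rewrite IHi addnS.
have E2 : (lucas i.+1 j * (i.+1`! * j`!) = (i.+1 + 2 * j) * (i + j)`!)%N.
  by rewrite IHj.
have -> : ((i.+1 + j.+1).-1 = (i + j).+1)%N by rewrite addSn addnS.
transitivity (i.+1 * (lucas i j.+1 * (i`! * j.+1`!))
            + j.+1 * (lucas i.+1 j * (i.+1`! * j`!)))%N.
  by rewrite [i.+1`!]factS [j.+1`!]factS; ring.
by rewrite E1 E2 factS; ring.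
Qed.

(** Even and odd indices need each other in the induction, since [c] enters the
    recurrence of Psi only every other step. *)
Lemma Psi_closed (R : realType) (a b : R) (m : nat) :
  let c := 2 * a - b in
  Psi a b (2 * m) =
    \sum_(j < m.+1) (lucas (2 * (m - j)) j)%:R * (- a) ^+ j * c ^+ (m - j) /\
  Psi a b (2 * m).+1 =
    \sum_(j < m.+1)
      (lucas (2 * (m - j)).+1 j)%:R * (- a) ^+ j * c ^+ (m - j).
Proof.
move=> c; elim: m => [|m [IHe IHo]].
  by rewrite !big_ord1 /= lucas0n lucasS0 !expr0 !mulr1.
have PsiE n : Psi a b n.+2 = c ^+ delta n.+1 * Psi a b n.+1 - a * Psi a b n.
  by [].
have d1 : delta (2 * m).+1 = 1%N by rewrite /delta; lia.
have d2 : delta (2 * m).+2 = 0%N by rewrite /delta; lia.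
have E : Psi a b (2 * m.+1) = \sum_(j < m.+2)
    (lucas (2 * (m.+1 - j)) j)%:R * (- a) ^+ j * c ^+ (m.+1 - j).
  rewrite mulnS !addSn add0n PsiE d1 expr1 IHo IHe.
  rewrite [in RHS]big_ord_recl [in RHS]big_ord_recr [X in c * X]big_ord_recl.
  rewrite [X in _ - a * X]big_ord_recr !lift0 /=.
  rewrite !(subnn, subn0, muln0, lucas0n).
  rewrite !mulrDr mulr_sumr mulr_sumr.
  rewrite -[LHS]addrA; congr (_ + _).
    by rewrite !expr0 !mulr1 !mul1r -exprS.
  rewrite opprD addrA; congr (_ + _); last first.
    by rewrite exprS expr0; ring.
  rewrite -sumrB; apply: eq_bigr => i _; rewrite /bump leq0n add1n subSS.
  have im : (m - i = (m - i.+1).+1)%N by case: i => i /=; lia.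
  have -> : (2 * (m - i) = (2 * (m - i.+1)).+2)%N by lia.
  rewrite [lucas _.+2 _.+1]lucasSS natrD im !exprS; ring.
split=> //.
rewrite mulnS !addSn add0n PsiE d2 expr0 mul1r.
have -> : (2 * m).+2 = (2 * m.+1)%N by lia.
rewrite E IHo [in RHS]big_ord_recl [X in X - _]big_ord_recl mulr_sumr -addrA -sumrB.
congr (_ + _).
apply: eq_bigr => i _; rewrite lift0 subSS.
rewrite lucasSS natrD !exprS; ring.
Qed.

(** * The coefficients of Omega *)

(** In the recursion, the factor [n - r - k] prolongs the second product, and
    [n - 2 r - delta (n - 1)] prolongs the first one, which for [r + 1] begins
    one step (of size 2) later; what remains is Pascal's rule. *)
Lemma Omega_closed (R : realType) r k (z xi : R) n :
  Omega r k z xi n = \sum_(j < k.+1)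
    'C(k, j)%:R * (2 * z - xi) ^+ (k - j) * (- (2 * z)) ^+ j
    * (\prod_(i < j) (n%:R - 2 * r%:R - (delta (n - 1))%:R - 2 * i%:R))
    * \prod_(i < k - j) (n%:R - r%:R - j%:R - 1 - i%:R).
Proof.
set c := 2 * z - xi; set d := (delta _)%:R.
elim: k r => [|k IHk] r; first by rewrite big_ord1 /= !big_ord0 !expr0 !mulr1.
rewrite [LHS]/= -/c -/d !IHk.
pose T j := c ^+ (k.+1 - j) * (- (2 * z)) ^+ j
    * (\prod_(i < j) (n%:R - 2 * r%:R - d - 2 * i%:R))
    * \prod_(i < k.+1 - j) (n%:R - r%:R - j%:R - 1 - i%:R).
transitivity (\sum_(j < k.+2) ('C(k.+1, j)%:R * T j)); last first.
  by apply: eq_bigr => j _; rewrite /T !mulrA.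
transitivity (\sum_(j < k.+1) 'C(k, j)%:R * T j
            + \sum_(j < k.+1) 'C(k, j)%:R * T j.+1).
  rewrite 2!mulr_sumr; congr (_ + _); last first.
    rewrite -sumrN; apply: eq_bigr => j _.
    rewrite /T subSS exprS big_ord_recl mulr0 subr0.
    rewrite [X in _ = _ * (_ * (_ * X) * _)](eq_bigr
      (fun i : 'I_j => n%:R - 2 * r.+1%:R - d - 2 * i%:R)).
      rewrite [X in _ = _ * (_ * X)](eq_bigr
        (fun i : 'I_(k - j) => n%:R - r.+1%:R - j%:R - 1 - i%:R)).
        ring.
      by move=> i _; rewrite -!natr1; ring.
    by move=> i _; rewrite /= /bump add1n -!natr1; ring.
  apply: eq_bigr => -[j /=]; rewrite ltnS => jk _.
  rewrite /T subSn // exprS big_ord_recr /= natrB // -natr1; ring.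
rewrite [in RHS]big_ord_recl [X in X + _]big_ord_recl !bin0 -addrA; congr (_ + _).
under [in RHS]eq_bigr => i _ do rewrite lift0 binS natrD mulrDl.
by rewrite big_split /= [in RHS]big_ord_recr /= bin_small // mul0r addr0.
Qed.

Lemma prod_sub_ffact (R : realType) (y l : nat) :
  \prod_(i < l) (y%:R - i%:R : R) = (y ^_ l)%:R.
Proof.
elim: l => [|l IHl]; first by rewrite big_ord0.
rewrite big_ord_recr /= IHl ffactnSr natrM.
have [le_ly | lt_yl] := leqP l y; first by rewrite natrB.
by rewrite ffact_small // !mul0r.
Qed.

(** Pairing each even factor of [(2 m) ^_ (2 j)] with a factor of [m ^_ j] leaves
    the odd factors. *)
Lemma odd_prod_ffact (R : realType) (m j : nat) :
  2 ^+ j * (\prod_(i < j) ((2 * m)%:R - 1 - 2 * i%:R : R)) * (m ^_ j)%:R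
  = ((2 * m) ^_ (2 * j))%:R.
Proof.
rewrite -!prod_sub_ffact; elim: j => [|j IHj].
  by rewrite muln0 !big_ord0 !mulr1.
rewrite mulnS !addSn add0n !big_ord_recr /= -IHj exprS -natr1 !natrM; ring.
Qed.

(** The coefficients of [(- a) ^+ j * c ^+ (m - j)] on both sides become equal
    after multiplication by [j! (2 (m - j))! (m - 1)!]: both are then
    [(2 m)! (2 m - 1 - j)!]. *)
Lemma Omega_Psi (R : realType) (m : nat) (a b : R) : (0 < m)%N ->
  Omega 0 m a b (2 * m) = ((2 * m - 1) ^_ m)%:R * Psi a b (2 * m).
Proof.
move=> m_gt0; rewrite Omega_closed (Psi_closed a b m).1 mulr_sumr.
apply: eq_bigr => -[j /=]; rewrite ltnS => jm _.
have -> : delta (2 * m - 1) = 1%N by rewrite /delta; lia.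
set P1 := \prod_(_ < j) _; set P2 := \prod_(_ < _) _.
have -> : P2 = ((2 * m - 1 - j) ^_ (m - j))%:R.
  rewrite -prod_sub_ffact; apply: eq_bigr => i _.
  by rewrite !natrB; [ring | lia..].
set c := 2 * a - b.
suff E : 'C(m, j)%:R * 2 ^+ j * P1 * ((2 * m - 1 - j) ^_ (m - j))%:R
    = ((2 * m - 1) ^_ m)%:R * (lucas (2 * (m - j)) j)%:R.
  have -> : - (2 * a) = 2 * - a by ring.
  rewrite exprMn [RHS]mulrA [in RHS]mulrA -E; ring.
have := odd_prod_ffact R m j.
have -> : \prod_(i < j) ((2 * m)%:R - 1 - 2 * i%:R : R) = P1.
  by apply: eq_bigr => i _; ring.
rewrite -bin_ffact => Eodd.
have nz : (j`! * (2 * (m - j))`! * (m - 1)`!)%:R != 0 :> R.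
  by rewrite pnatr_eq0 -lt0n !muln_gt0 !fact_gt0.
apply: (mulIf nz).
have F1 : ((2 * m) ^_ (2 * j) * (2 * (m - j))`! = (2 * m)`!)%N.
  by rewrite -(@ffact_fact (2 * m) (2 * j)) ?mulnBr ?leq_mul2l.
have F2 : ((2 * m - 1 - j) ^_ (m - j) * (m - 1)`! = (2 * m - 1 - j)`!)%N.
  rewrite -(@ffact_fact (2 * m - 1 - j) (m - j)); last lia.
  by congr (_ * _`!)%N; lia.
have F3 : ((2 * m - 1) ^_ m * (m - 1)`! = (2 * m - 1)`!)%N.
  rewrite -(@ffact_fact (2 * m - 1) m); last lia.
  by congr (_ * _`!)%N; lia.
have F4 : (lucas (2 * (m - j)) j * ((2 * (m - j))`! * j`!)
           = 2 * m * (2 * m - 1 - j)`!)%N.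
  rewrite lucas_fact; last lia.
  by congr (_ * _`!)%N; lia.
have F5 : ((2 * m)`! = 2 * m * (2 * m - 1)`!)%N.
  by case: (m) m_gt0 => // m' _; rewrite mulnS add2n factS subn1.
transitivity ((2 ^+ j * P1 * ('C(m, j) * j`!)%:R) * ((2 * (m - j))`!)%:R
   * ((2 * m - 1 - j) ^_ (m - j) * (m - 1)`!)%:R).
  by rewrite !natrM; ring.
rewrite Eodd -!natrM F1 F2 F5; congr (_%:R).
transitivity (((2 * m - 1) ^_ m * (m - 1)`!) *
   (lucas (2 * (m - j)) j * ((2 * (m - j))`! * j`!)))%N; last by ring.
by rewrite F3 F4; ring.
Qed.

(** * The next prime and the ratio *)

Lemma next_primeP m :
  [/\ (m < next_prime m)%N, prime (next_prime m)
    & forall p, (m < p)%N -> prime p -> (next_prime m <= p)%N].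
Proof.
rewrite /next_prime; case: ex_minnP => q /andP[lt_mq pq] min_q.
by split=> // p lt_mp pp; apply: min_q; rewrite lt_mp.
Qed.

Lemma nth_primeS k : (0 < k)%N -> nth_prime k.+1 = next_prime (nth_prime k).
Proof. by case: k. Qed.

Lemma nth_prime_gt2 k : (1 < k)%N -> (2 < nth_prime k)%N.
Proof.
case: k => [|[|k]] // _; elim: k => [|k IHk]; first by have [] := next_primeP 2.
rewrite nth_primeS //; apply: ltn_trans IHk _.
by have [] := next_primeP (nth_prime k.+2).
Qed.

(** The prime given by Bertrand's postulate may equal [2 m] only for [m = 1]. *)
Lemma next_prime_lt m : (1 < m)%N -> (next_prime m < 2 * m)%N.
Proof.
move=> m_gt1; have [_ _ min_q] := next_primeP m.
have [|p pp /andP[lt_mp le_p]] := @bertrand m; first exact: ltnW.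
apply: leq_ltn_trans (min_q p lt_mp pp) _.
rewrite mul2n ltn_neqAle le_p andbT; apply/eqP => p2m.
have := dvdn_prime2 (isT : prime 2) pp; rewrite p2m -mul2n dvdn_mulr //.
by move=> /esym/eqP; lia.
Qed.

Lemma next_prime_dvd_ffact m : (1 < m)%N ->
  (next_prime m %| (2 * m - 1) ^_ m)%N.
Proof.
move=> m_gt1; have lt_q := next_prime_lt m_gt1.
by have [lt_mq pq _] := next_primeP m; apply: prime_dvd_ffact => //; lia.
Qed.

Lemma int_multiple_sum (R : realType) (d : nat) (T : eqType) (s : seq T)
    (F : T -> R) :
  (forall x, x \in s -> int_multiple d (F x)) ->
  int_multiple d (\sum_(x <- s) F x).
Proof.
move=> dF; rewrite big_seq.
elim/big_ind: _ => [|_ _ [m -> dm] [n -> dn]|//]; first by exists 0.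
by exists (m + n); rewrite ?intrD ?rpredD.
Qed.

Lemma int_multipleMl (R : realType) (d : nat) (l : int) (x : R) :
  int_multiple d x -> int_multiple d (l%:~R * x).
Proof.
by move=> [m -> dm]; exists (l * m); rewrite ?intrM // dvdz_mull.
Qed.

Theorem theorem38 (R : realType) (k : nat) (hk : (1 < k)%N) :
  let p := nth_prime k in
  let q := nth_prime k.+1 in
  let ratio := fun ab : R * R =>
    Omega 0 p ab.1 ab.2 (2 * p)%N / Psi ab.1 ab.2 (2 * p)%N in
  (forall ab : R * R, ab \in omega R (2 * p)%N ->
     ratio ab \is a Num.int /\ int_multiple q (ratio ab)) /\
  (forall (varpi : {fset R * R}) (I : {fset int}),
     {subset varpi <= omega R (2 * p)%N} ->
     int_multiple q (\sum_(ab <- varpi) \sum_(l <- I) l%:~R * ratio ab)).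
Proof.
move=> p q ratio.
have p_gt2 : (2 < p)%N by apply: nth_prime_gt2.
have qE : q = next_prime p by rewrite -nth_primeS // ltnW.
have main ab : ab \in omega R (2 * p)%N ->
    ratio ab \is a Num.int /\ int_multiple q (ratio ab).
  move=> /andP[_ Psi_neq0].
  have -> : ratio ab = ((2 * p - 1) ^_ p)%:R.
    by rewrite /ratio Omega_Psi ?mulfK // ltnW // ltnW.
  split; first exact: natr_int.
  exists ((2 * p - 1) ^_ p)%:Z => //.
  by rewrite dvdzE /= qE next_prime_dvd_ffact // ltnW.
split=> // varpi I varpi_omega.
apply: int_multiple_sum => ab ab_varpi; apply: int_multiple_sum => l _.
by apply: int_multipleMl; have [] := main ab (varpi_omega _ ab_varpi).
Qed.
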